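(* Suppose that the vector field $\mathbf{f}$ of the autonomous equation $\mathbf{x}'(t)=\mathbf{f}(\mathbf{x}(t))$ and its derivatives up to order $\gamma$ are defined and bounded on $\mathbb{R}^d$. Then all equilibrium points of this ODE are fixed points of any LLRK discretization; that is, if $\mathbf{f}(\boldsymbol{\xi})=\mathbf{0}$ then $\boldsymbol{\xi}+h\boldsymbol{\varphi}_\gamma(\boldsymbol{\xi},h)=\boldsymbol{\xi}$ for every step size $h$.
   Context: Let $\gamma>2$ be an integer and let an explicit $s$-stage Runge-Kutta scheme of order $\gamma$ with coefficients $c_i,a_{ij},b_i$ be given. For the autonomous ODE $\mathbf{x}'=\mathbf{f}(\mathbf{x})$ in $\mathbb{R}^d$, with Jacobian $\mathbf{f}_{\mathbf{x}}$, the order $\gamma$ Local Linearization-Runge Kutta (LLRK) discretization with uniform step $h>0$ is $$\mathbf{y}_{n+1}=\mathbf{y}_n+h\boldsymbol{\varphi}_\gamma(\mathbf{y}_n,h),\qquad \boldsymbol{\varphi}_\gamma(\boldsymbol{\xi},\delta)=\Phi(\boldsymbol{\xi},\delta)\mathbf{f}(\boldsymbol{\xi})+\sum_{i=1}^s b_i\mathbf{k}_i(\boldsymbol{\xi},\delta),$$ where $$\Phi(\boldsymbol{\xi},\delta)=\frac1\delta\int_0^\delta e^{\mathbf{f}_{\mathbf{x}}(\boldsymbol{\xi})u}du,\qquad \mathbf{k}_i(\boldsymbol{\xi},\delta)=\mathbf{q}\Big(\boldsymbol{\xi};c_i\delta,\delta\sum_{j=1}^{i-1}a_{ij}\mathbf{k}_j(\boldsymbol{\xi},\delta)\Big),$$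 $$\mathbf{q}(\boldsymbol{\xi};\delta,\mathbf{u})=\mathbf{f}(\boldsymbol{\xi}+\delta\Phi(\boldsymbol{\xi},\delta)\mathbf{f}(\boldsymbol{\xi})+\mathbf{u})-\mathbf{f}_{\mathbf{x}}(\boldsymbol{\xi})\delta\Phi(\boldsymbol{\xi},\delta)\mathbf{f}(\boldsymbol{\xi})-\mathbf{f}(\boldsymbol{\xi}),$$ with $\delta\Phi(\boldsymbol{\xi},\delta)$ read as $\mathbf{0}$ at $\delta=0$. *)

(* Defs.v *)
From HB Require Import structures.
From mathcomp Require Import all_boot all_order all_algebra.
From mathcomp Require Import all_classical all_reals all_analysis.

Set Implicit Arguments.
Unset Strict Implicit.
Unset Printing Implicit Defensive.

Import Order.TTheory GRing.Theory Num.Theory.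
Import numFieldNormedType.Exports.
Local Open Scope classical_set_scope.
Local Open Scope ring_scope.

(* Vectors are rows, as in the library's Jacobian: 'J f x is the transpose of
   the usual Jacobian matrix, and the usual product f_x v is v *m 'J f x. *)

Fixpoint deriv_dim (n m k : nat) : nat :=
  if k is k'.+1 then (n * deriv_dim n m k')%N else m.

(* The k-th Frechet derivative of f, as a vector: the coordinates of
   iter_deriv f k x are the k-th order partial derivatives of the coordinates
   of f at x.  Meaningful where the lower ones are differentiable. *)
Fixpoint iter_deriv (R : realType) (n m : nat) (f : 'rV[R]_n -> 'rV[R]_m)
    (k : nat) : 'rV[R]_n -> 'rV[R]_(deriv_dim n m k) :=
  if k is k'.+1 then fun x => mxvec ('J (iter_deriv f k') x) else f.

Definition times_differentiable (R : realType) (n m : nat) (p : nat)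
    (f : 'rV[R]_n -> 'rV[R]_m) : Prop :=
  forall (k : nat) (x : 'rV[R]_n), (k < p)%N -> differentiable (iter_deriv f k) x.

Definition smooth (R : realType) (n m : nat) (f : 'rV[R]_n -> 'rV[R]_m) : Prop :=
  forall p : nat, times_differentiable p f.

Definition bounded_derivs_upto (R : realType) (n m : nat) (p : nat)
    (f : 'rV[R]_n -> 'rV[R]_m) : Prop :=
  times_differentiable p f /\
  forall k : nat, (k <= p)%N -> bounded_fun (iter_deriv f k).

Record explicit_RK (R : realType) (s : nat) := ExplicitRK {
  rk_c : 'I_s -> R;
  rk_a : 'I_s -> 'I_s -> R;  (* only the entries with j < i are ever used *)
  rk_b : 'I_s -> R
}.

Section Stages.
Variables (R : realType) (s m : nat) (rk : explicit_RK R s).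
(* F i u is the value of stage i when sum_(j < i) a_ij k_j equals u. *)
Variable F : 'I_s -> 'rV[R]_m -> 'rV[R]_m.

Fixpoint rk_stage_rec (n : nat) (i : 'I_s) : 'rV[R]_m :=
  if n is n'.+1 then
    F i (\sum_(j < s | (j < i)%N) rk_a rk i j *: rk_stage_rec n' j)
  else 0.

Definition rk_stage (i : 'I_s) : 'rV[R]_m := rk_stage_rec i.+1 i.

Lemma rk_stageE (i : 'I_s) :
  rk_stage i = F i (\sum_(j < s | (j < i)%N) rk_a rk i j *: rk_stage j).
Proof.
have fuel n n' (j : 'I_s) :
    (j < n)%N -> (j < n')%N -> rk_stage_rec n j = rk_stage_rec n' j.
  elim: n n' j => [|n IHn] [|n'] j //= lt_jn lt_jn'.
  congr F; apply: eq_bigr => k lt_kj; congr (_ *: _).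
  by apply: IHn; apply: leq_trans lt_kj _.
by rewrite {1}/rk_stage /=; congr F; apply: eq_bigr => j lt_ji; rewrite (fuel _ j.+1).
Qed.

End Stages.

(* One step of length h for y' = g(t, y), from (t0, y0). *)
Definition rk_step (R : realType) (s m : nat) (rk : explicit_RK R s)
    (g : R -> 'rV[R]_m -> 'rV[R]_m) (t0 : R) (y0 : 'rV[R]_m) (h : R) : 'rV[R]_m :=
  let k := rk_stage rk (fun i u => g (t0 + rk_c rk i * h) (y0 + h *: u)) in
  y0 + h *: \sum_(i < s) rk_b rk i *: k i.

(* Order (at least) p: the local error is O(h^(p+1)) for every smooth problem,
   in every dimension. *)
Definition rk_order (R : realType) (s : nat) (rk : explicit_RK R s) (p : nat) : Prop :=
  forall (m : nat) (g : R -> 'rV[R]_m -> 'rV[R]_m)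
         (t0 : R) (y : R -> 'rV[R]_m),
    smooth (fun z : 'rV[R]_(1 + m) => g (lsubmx z 0 0) (rsubmx z)) ->
    (\forall t \near t0, is_derive t (1 : R) y (g t (y t))) ->
    exists C : R, \forall h \near 0^'+,
      `|y (t0 + h) - rk_step rk g t0 (y t0) h| <= C * h ^+ p.+1.

Definition expmx (R : realType) (n : nat) (A : 'M[R]_n) : 'M[R]_n :=
  limn (series (fun k : nat => (k`!%:R)^-1 *: A ^+ k)).

(* Oriented: the nodes c_i of a scheme may be negative. *)
Definition oriented_integral (R : realType) (a b : R) (F : R -> R) : R :=
  if a <= b then \int[@lebesgue_measure R]_(u in `[a, b]) F u
  else - \int[@lebesgue_measure R]_(u in `[b, a]) F u.

Section LLRK.
Variables (R : realType) (d s : nat) (rk : explicit_RK R s).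
Variable f : 'rV[R]_d -> 'rV[R]_d.

(* Since 0^-1 = 0, delta *: LLRK_Phi xi delta is 0 at delta = 0. *)
Definition LLRK_Phi (xi : 'rV[R]_d) (delta : R) : 'M[R]_d :=
  delta^-1 *: \matrix_(i, j)
    oriented_integral 0 delta (fun u => expmx (u *: 'J f xi) i j).

Definition LLRK_q (xi : 'rV[R]_d) (delta : R) (u : 'rV[R]_d) : 'rV[R]_d :=
  let v := f xi *m (delta *: LLRK_Phi xi delta) in
  f (xi + v + u) - v *m 'J f xi - f xi.

Definition LLRK_k (xi : 'rV[R]_d) (delta : R) : 'I_s -> 'rV[R]_d :=
  rk_stage rk (fun i u => LLRK_q xi (rk_c rk i * delta) (delta *: u)).

Definition LLRK_phi (xi : 'rV[R]_d) (delta : R) : 'rV[R]_d :=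
  f xi *m LLRK_Phi xi delta + \sum_(i < s) rk_b rk i *: LLRK_k xi delta i.

End LLRK.

(* Main.v *)
Require Import Defs.
From mathcomp Require Import all_boot all_order all_algebra.
From mathcomp Require Import all_classical all_reals all_analysis.
Import Order.TTheory GRing.Theory Num.Theory.
Import numFieldNormedType.Exports.
Local Open Scope ring_scope.

(** At an equilibrium every [f xi *m _] vanishes: the first term of [LLRK_phi], and the shift in
    [LLRK_q], so [LLRK_q] at increment 0 is [f xi - 0 - f xi = 0] for any node. Explicitness spreads
    this zero to all stages ([rk_stage_eq0]). *)

Lemma rk_stage_eq0 (R : realType) (s m : nat) (rk : explicit_RK R s)
    (F : 'I_s -> 'rV[R]_m -> 'rV[R]_m) :
  (forall i, F i 0 = 0) -> forall i, rk_stage rk F i = 0.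
Proof.
(* Strong induction on the stage index: stage [i] is [F i] at a combination of stages [j < i], all
   zero by induction. *)
move=> F0 i; have [n] := ubnP (i : nat); elim: n i => // n IHn i /ltnSE le_in.
rewrite rk_stageE big1 // => j lt_ji.
by rewrite IHn ?scaler0 //; apply: leq_trans lt_ji le_in.
Qed.

Lemma LLRK_q_equilibrium (R : realType) (d : nat) (f : 'rV[R]_d -> 'rV[R]_d)
    (xi : 'rV[R]_d) (delta : R) : f xi = 0 -> LLRK_q f xi delta 0 = 0.
Proof. by move=> fxi0; rewrite /LLRK_q fxi0 !mul0mx !addr0 fxi0 !subr0. Qed.

Theorem theorem9 (R : realType) (d s gamma : nat) (rk : explicit_RK R s)
    (f : 'rV[R]_d -> 'rV[R]_d)
    (gamma_gt2 : (2 < gamma)%N)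
    (rk_gamma : rk_order rk gamma)
    (f_bounded : bounded_derivs_upto gamma f) :
  forall xi : 'rV[R]_d, f xi = 0 ->
  forall h : R, 0 < h -> xi + h *: LLRK_phi rk f xi h = xi.
Proof.
move=> xi fxi0 h _; rewrite /LLRK_phi fxi0 mul0mx add0r big1 ?scaler0 ?addr0 //.
(* At argument 0 the stage map is [LLRK_q] with increment [h *: 0 = 0], at node [rk_c rk j * h]. *)
move=> i _; rewrite /LLRK_k rk_stage_eq0 ?scaler0 // => j.
exact: LLRK_q_equilibrium.
Qed.
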